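(* Consider the problem $$(\mathrm{CP})\qquad\inf_{\mathbf x\in\mathbb R^n}\{f(\mathbf x): g_i(\mathbf x)\le0,\ i=1,\dots,m\},$$ where $f=s_0+p_0$ and $g_i=s_i+p_i$ ($i=1,\dots,m$) are convex polynomials such that, for each $i=0,1,\dots,m$, $s_i(\mathbf x)=\sum_{j=1}^n u_i^j(x_j)$ with each $u_i^j$ a convex univariate polynomial in $x_j$ of degree at most $2d_j$, and $p_i$ is an SOS-convex polynomial of degree at most $2r$. Let $d_0:=\max_{1\le j\le n}d_j$ and assume $d_0>r$ and that $f$ is bounded from below on the feasible set $\mathbf F=\{\mathbf x: g_i(\mathbf x)\le0,\ i=1,\dots,m\}$. Assume there exists $\widehat{\mathbf x}\in\mathbf F$ with $g_i(\widehat{\mathbf x})<0$ for all $i$. If $\bar{\mathbf y}\in\mathbb R^{s(n,2d_0)}$ is an optimal solution of the problem $(\widetilde{\mathrm D}^{\mathrm{SPLD}}_{\mathrm{sos}})$ defined in the context, then $\bar{\mathbf x}:=(\bar y_{\boldsymbol\alpha})_{|\boldsymbol\alpha|=1}\in\mathbb R^n$ is an optimal solution of $(\mathrm{CP})$.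
   Context: A polynomial is SOS-convex if its Hessian is an SOS matrix polynomial, i.e., $\nabla^2 p(\mathbf x)=F(\mathbf x)^TF(\mathbf x)$ for some matrix polynomial $F$. $\mathbb N^n_d=\{\boldsymbol\alpha\in\mathbb N^n:|\boldsymbol\alpha|\le d\}$; $\lceil\mathbf x\rceil_r=(\mathbf x^{\boldsymbol\alpha})_{\boldsymbol\alpha\in\mathbb N^n_r}$; $s(n,d)=\binom{n+d}{d}$; $\lceil x_j\rceil_{d}=(1,x_j,\dots,x_j^{d})^T$; $(M)_{\boldsymbol\alpha}$ is the coefficient matrix of $\mathbf x^{\boldsymbol\alpha}$ in a polynomial matrix $M$, and $h_{\boldsymbol\alpha}$ the coefficient of $\mathbf x^{\boldsymbol\alpha}$ in a polynomial $h$. $(\widetilde{\mathrm D}^{\mathrm{SPLD}}_{\mathrm{sos}})$: minimize $\sum_{\boldsymbol\alpha\in\mathbb N^n_{2d_0}}f_{\boldsymbol\alpha}y_{\boldsymbol\alpha}$ over $\mathbf y=(y_{\boldsymbol\alpha})_{\boldsymbol\alpha\in\mathbb N^n_{2d_0}}\in\mathbb R^{s(n,2d_0)}$ subject to $\sum_{\boldsymbol\alpha\in\mathbb N^n_{2d_0}}(g_i)_{\boldsymbol\alpha}y_{\boldsymbol\alpha}\le0$, $i=1,\dots,m$; $\sum_{\boldsymbol\alpha\in\mathbb N^n_{2d_0}}y_{\boldsymbol\alpha}(\lceil x_j\rceil_{d_j}\lceil x_j\rceil_{d_j}^T)_{\boldsymbol\alpha}\succeq0$, $j=1,\dots,n$;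 $\sum_{\boldsymbol\alpha\in\mathbb N^n_{2d_0}}y_{\boldsymbol\alpha}(\lceil\mathbf x\rceil_r\lceil\mathbf x\rceil_r^T)_{\boldsymbol\alpha}\succeq0$; $y_{\mathbf 0}=1$. *)

(* Defs.v *)
From HB Require Import structures.
From mathcomp Require Import all_boot all_order all_algebra.
From mathcomp Require Import reals.
From mathcomp Require Import mpoly.

Set Implicit Arguments.
Unset Strict Implicit.
Unset Printing Implicit Defensive.

Import Order.TTheory GRing.Theory Num.Theory.
Local Open Scope ring_scope.

Section Defs.
Variable R : realType.
Variable n : nat.

Definition convex_mpoly (p : {mpoly R[n]}) : Prop :=
  forall (x y : 'I_n -> R) (t : R), 0 <= t <= 1 ->
    p.@[fun k => t * x k + (1 - t) * y k] <= t * p.@[x] + (1 - t) * p.@[y].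

Definition convex_poly (q : {poly R}) : Prop :=
  forall (x y t : R), 0 <= t <= 1 ->
    q.[t * x + (1 - t) * y] <= t * q.[x] + (1 - t) * q.[y].

Definition univ (j : 'I_n) (q : {poly R}) : {mpoly R[n]} :=
  (map_poly (@mpolyC n R) q).['X_j].

Definition hessian (p : {mpoly R[n]}) : 'M[{mpoly R[n]}]_n :=
  \matrix_(i, j) mderiv i (mderiv j p).

Definition sos_matrix (H : 'M[{mpoly R[n]}]_n) : Prop :=
  exists k (F : 'M[{mpoly R[n]}]_(k, n)), H = F^T *m F.

Definition sos_convex (p : {mpoly R[n]}) : Prop := sos_matrix (hessian p).

Definition psd (T : finType) (M : T -> T -> R) : Prop :=
  forall v : T -> R, 0 <= \sum_(a : T) \sum_(b : T) v a * M a b * v b.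

(* sum_{alpha in N^n_D} h_alpha y_alpha  (coefficients vanish off the support) *)
Definition Lfun (D : nat) (y : 'X_{1..n} -> R) (h : {mpoly R[n]}) : R :=
  \sum_(a <- msupp h | (mdeg a <= D)%N) h@_a * y a.

Definition cp_feasible (m : nat) (g : 'I_m -> {mpoly R[n]}) (x : 'I_n -> R) : Prop :=
  forall i, (g i).@[x] <= 0.

Definition cp_optimal (m : nat) (f : {mpoly R[n]}) (g : 'I_m -> {mpoly R[n]})
    (x : 'I_n -> R) : Prop :=
  cp_feasible g x /\ forall z, cp_feasible g z -> f.@[x] <= f.@[z].

(* Problem (~D^SPLD_sos); the variable y is indexed by all monomials but only the
   coordinates with |alpha| <= 2 d0 occur in the objective and constraints. *)
Definition spld_feasible (d : 'I_n -> nat) (r m : nat) (g : 'I_m -> {mpoly R[n]})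
    (y : 'X_{1..n} -> R) : Prop :=
  let D := (2 * \max_(j < n) d j)%N in
  [/\ forall i, Lfun D y (g i) <= 0,
      (* sum_alpha y_alpha (ceil(x_j)_{d_j} ceil(x_j)_{d_j}^T)_alpha >= 0 *)
      forall j, psd (fun a b : 'I_(d j).+1 => y (U_(j) *+ (a + b))%MM),
      (* sum_alpha y_alpha (ceil(x)_r ceil(x)_r^T)_alpha >= 0 *)
      psd (fun b c : 'X_{1..n < r.+1} => y (bmnm b + bmnm c)%MM) &
      y 0%MM = 1].

Definition spld_optimal (d : 'I_n -> nat) (r m : nat) (f : {mpoly R[n]})
    (g : 'I_m -> {mpoly R[n]}) (y : 'X_{1..n} -> R) : Prop :=
  let D := (2 * \max_(j < n) d j)%N in
  spld_feasible d r g y /\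
  forall z, spld_feasible d r g z -> Lfun D y f <= Lfun D z f.

End Defs.

(* Main.v *)
(**
The moment functional [L = Lfun D y] of a feasible [y] satisfies Jensen's
inequality [h(xbar) <= L(h)] at its mean [xbar = (L(x_1), ..., L(x_n))] for
[h = f] and for every [h = g_i].  Hence [xbar] is feasible, and since the moment
vector of any feasible point [z] is feasible for the relaxation,
[f(xbar) <= L(f) <= f(z)].

For the separable part, the gap between a convex univariate polynomial and its
tangent at [xbar_j] is nonnegative, hence a sum of squares, on which [L] is
nonnegative.  For an SOS-convex [p], the univariate polynomial
[phi(s) = L(p(xbar + s (x - xbar)))] satisfies [phi(0) = p(xbar)],
[phi(1) = L(p)], [phi'(0) = 0], and [phi''(s)] is the value of [L] at a sum of
squares of polynomials of degree at most [r]; so [phi(1) >= phi(0)].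
*)
Require Import Defs.
From HB Require Import structures.
From mathcomp Require Import all_boot all_order all_algebra.
From mathcomp Require Import reals.
From mathcomp Require Import polyrcf complex ring lra.
From mathcomp Require Import ssrcomplements mpoly.

Import Order.TTheory GRing.Theory Num.Theory.
Local Open Scope ring_scope.

(** * Univariate polynomials: sums of squares and tangents *)

Section Univariate.
Variable R : rcfType.
Implicit Types (p q h : {poly R}) (a x : R).

(** By continuity, a negative value at [a] would persist at some point just to the right of [a]. *)
Lemma horner_ge0_right p a e : 0 < e ->
  (forall x, a < x < a + e -> 0 <= p.[x]) -> 0 <= p.[a].
Proof.
move=> e0 pge0; rewrite leNgt; apply/negP => pa0.
have [|d d0 Hd] := @poly_cont R a p (- p.[a]); first by rewrite oppr_gt0.
have m0 : 0 < Num.min d e by rewrite lt_min d0.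
have md : Num.min d e <= d by rewrite ge_min lexx.
have me : Num.min d e <= e by rewrite ge_min lexx orbT.
have := pge0 (a + Num.min d e / 2); have := Hd (a + Num.min d e / 2).
rewrite addrC addKr ger0_norm; last by lra.
move=> /(_ ltac:(lra)); rewrite ltr_norml => /andP[_ h1].
move=> /(_ ltac:(apply/andP; split; lra)); lra.
Qed.

Lemma horner_ge0_punctured p a :
  (forall x, x != a -> 0 <= p.[x]) -> forall x, 0 <= p.[x].
Proof.
move=> pge0 x; case: (eqVneq x a) => [->|/pge0 //].
apply: (@horner_ge0_right p a 1) => // y /andP[ay _].
by apply: pge0; rewrite gt_eqF.
Qed.

(** Dividing by X - a once leaves [q2], which is nonnegative to the right of [a] and nonpositive to
    the left; so [q2] vanishes at [a] as well. *)
Lemma nonneg_double_root q a : (forall x, 0 <= q.[x]) -> root q a ->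
  exists q1, q = ('X - a%:P) ^+ 2 * q1.
Proof.
move=> q0 /factor_theorem[q2 qE].
suff /factor_theorem[q1 q2E] : root q2 a.
  by exists q1; rewrite qE q2E expr2; ring.
rewrite /root; apply/eqP; apply/le_anti/andP; split.
- rewrite -oppr_ge0.
  (* The reflection x -> 2a - x turns the left-hand side of [a] into the right-hand side. *)
  have -> : - q2.[a] = (- (q2 \Po ((2 * a)%:P - 'X))).[a].
    by rewrite !hornerE horner_comp !hornerE; congr (- _.[_]); ring.
  apply: (@horner_ge0_right _ a 1) => // x /andP[ax _].
  rewrite !hornerE horner_comp !hornerE oppr_ge0.
  have := q0 (2 * a - x); rewrite qE !hornerE.
  by rewrite nmulr_lge0 //; lra.
- apply: (@horner_ge0_right _ a 1) => // x /andP[ax _].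
  by have := q0 x; rewrite qE !hornerE pmulr_lge0 // subr_gt0.
Qed.

(** The conjugate is also a root, distinct since [b != 0], and the quadratic is the product of the
    two complex linear factors. *)
Lemma nonreal_root_dvdp q (a b : R) : b != 0 ->
  root (map_poly (real_complex R) q) (a +i* b)%C ->
  ('X - a%:P) ^+ 2 + (b ^+ 2)%:P %| q.
Proof.
move=> b0 rt; rewrite -(dvdp_map (real_complex R)).
set z := (a +i* b)%C in rt *.
have rt' : root (map_poly (real_complex R) q) (a -i* b)%C.
  have := rt; rewrite -[z]conjcK -complex_root_conj -map_poly_comp.
  rewrite (eq_map_poly (g := real_complex R)) => [|x /=]; last by rewrite oppr0.
  by [].
have -> : map_poly (real_complex R) (('X - a%:P) ^+ 2 + (b ^+ 2)%:P) =
          \prod_(w <- [:: z; (a -i* b)%C]) ('X - w%:P).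
  rewrite !big_cons big_nil mulr1 rmorphD rmorphXn rmorphB /= map_polyX !map_polyC /=.
  have -> : z = a%:C%C + 'i%C * b%:C%C by rewrite /z [LHS]complexE.
  have -> : (a -i* b)%C = a%:C%C - 'i%C * b%:C%C.
    by rewrite [LHS]complexE /= rmorphN mulrN.
  rewrite rmorphXn /= !polyCB !polyCD !polyCM.
  have : 'i%C%:P ^+ 2 = -1 :> {poly R[i]} by rewrite -polyC_exp sqr_i polyCN.
  set I := 'i%C%:P => I2.
  (* [ring] does not know that I^2 = -1. Subtracting (I^2 + 1) b^2, which is zero, leaves an
     identity valid for an indeterminate I. *)
  rewrite -[LHS]subr0 -(mul0r ((b%:C)%C%:P ^+ 2)) -(subrr (-1)) -{1}I2.
  ring.
apply: uniq_roots_dvdp; first by rewrite /= rt rt'.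
rewrite /= !andbT /diff_roots unitfE mulrC eqxx /=.
by rewrite subr_eq0 eq_complex /= eqxx /= eq_sym -addr_eq0 -mulr2n mulrn_eq0.
Qed.

(** Induction on [d]: a complex root a + ib yields a factor (X - a)^2 + b^2, also when b = 0 because
    real roots are double, and the quotient is again nonnegative. The size bound on the squares is
    what lets a moment matrix of order [d] act on them. *)
Lemma nonneg_poly_sos d q : (forall x, 0 <= q.[x]) -> (size q <= (2 * d).+1)%N ->
  exists2 hs : seq {poly R}, q = \sum_(h <- hs) h ^+ 2 &
    forall h, h \in hs -> (size h <= d.+1)%N.
Proof.
elim: d q => [|d IH] q q0 sq.
  move/size1_polyC: sq => qE; exists [:: (Num.sqrt q`_0)%:P].
    rewrite big_seq1 -polyC_exp sqr_sqrtr //.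
    by have := q0 0; rewrite {1}qE hornerC.
  by move=> h; rewrite inE => /eqP->; apply: size_polyC_leq1.
have [sq1|sq1] := leqP (size q) 1.
  have [|hs qE Hhs] := IH q q0; first by apply: leq_trans sq1 _.
  by exists hs => // h /Hhs /leqW.
have [[a b] rt] : exists z, root (map_poly (real_complex R) q) z.
  by apply/closed_rootP; rewrite size_map_poly neq_ltn sq1 orbT.
have [q1 qE q1_0] : exists2 q1,
    q = (('X - a%:P) ^+ 2 + (b ^+ 2)%:P) * q1 & forall x, 0 <= q1.[x].
  have [b0|b0] := eqVneq b 0.
    have [|q1 qE] := @nonneg_double_root q a q0.
      by move: rt; rewrite b0 -[(a +i* 0)%C]/(a%:C)%C fmorph_root.
    exists q1; first by rewrite b0 expr0n addr0.
    (* The sign of the quotient is read off directly away from [a], and at [a] by continuity. *)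
    apply: (@horner_ge0_punctured q1 a) => x xa.
    have := q0 x; rewrite qE !hornerE pmulr_rge0 //.
    by rewrite exprn_even_gt0 //= subr_eq0.
  have /dvdpP[q1 qE] := nonreal_root_dvdp _ _ _ b0 rt.
  exists q1 => [|x]; first by rewrite qE mulrC.
  have := q0 x; rewrite qE !hornerE pmulr_lge0 // ltr_wpDl ?sqr_ge0 //.
  by rewrite exprn_even_gt0.
have sQ : size (('X - a%:P) ^+ 2 + (b ^+ 2)%:P) = 3%N.
  have s2 : size (('X - a%:P) ^+ 2) = 3%N by rewrite size_exp_XsubC.
  by rewrite size_polyDl s2 // (leq_ltn_trans (size_polyC_leq1 _)).
have q1n0 : q1 != 0 by apply: contraTneq sq1 => q10; rewrite qE q10 mulr0 size_poly0.
have [|hs q1E Hhs] := IH q1 q1_0.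
  move: sq; rewrite qE size_mul ?sQ //; last by rewrite -size_poly_gt0 sQ.
  by rewrite /= !addSn add0n mulnS !ltnS.
(* Each square h^2 of [q1] contributes ((X - a) h)^2 and (b h)^2; for a real root the latter are
   zero. *)
exists ([seq ('X - a%:P) * h | h <- hs] ++ [seq b%:P * h | h <- hs]).
  rewrite big_cat !big_map qE q1E mulrDl !mulr_sumr polyC_exp.
  by congr (_ + _); apply: eq_bigr => h _; rewrite exprMn.
move=> h; rewrite mem_cat => /orP[] /mapP[k /Hhs sk ->].
  by rewrite (leq_trans (size_polyMleq _ _)) // size_XsubC /= ltnS.
by rewrite mul_polyC (leq_trans (size_scale_leq _ _)) // leqW.
Qed.
End Univariate.

(** [psi] is the chord minus the function along the segment from [a] to [x]. It is nonnegative on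
    (0, 1) and vanishes at 0, so psi'(0) >= 0, which is the claim. The quotient [w] of [psi] by X
    gives this derivative as w(0), without limits. *)
Lemma convex_poly_tangent (R : realType) (v : {poly R}) a x : convex_poly v ->
  v.[a] + v^`().[a] * (x - a) <= v.[x].
Proof.
move=> cv.
pose psi := (v.[a])%:P + (v.[x] - v.[a])%:P * 'X
            - (v \Po (a%:P + (x - a)%:P * 'X)).
have psi00 : root psi 0.
  by rewrite /root !hornerE horner_comp !hornerE ?(mulr0, addr0) subrr.
have [w psiE] := factor_theorem _ _ psi00.
have : 0 <= w.[0].
  apply: (@horner_ge0_right _ w 0 1) => // t /andP[t0 t1].
  have : 0 <= psi.[t].
    have := cv x a t; rewrite (ltW t0) /= => /(_ ltac:(lra)).
    rewrite !hornerE horner_comp !hornerE.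
    have -> : a + (x - a) * t = t * x + (1 - t) * a by ring.
    lra.
  by rewrite psiE !hornerE ?subr0 pmulr_lge0.
have : psi^`().[0] = w.[0].
  by rewrite psiE derivM !derivE !hornerE; ring.
rewrite /psi !derivE deriv_comp !derivE !hornerE horner_comp !hornerE.
rewrite ?(mulr0, addr0, add0r, mul0r) => <- /=; rewrite mulr1.
lra.
Qed.

(** * Multivariate polynomials: induction and total degree ([msize] is the degree plus one) *)

Lemma mpoly_alg_ind (n : nat) (R : nzRingType) (P : {mpoly R[n]} -> Prop) :
  (forall c, P c%:MP) -> (forall i, P 'X_i) ->
  (forall p q, P p -> P q -> P (p + q)) ->
  (forall p q, P p -> P q -> P (p * q)) -> forall p, P p.
Proof.
move=> PC PX PD PM p; rewrite (mpolyE p).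
have P0 : P 0 by rewrite -mpolyC0.
have P1 : P 1 by rewrite -mpolyC1.
apply: big_ind => // m _; rewrite -mul_mpolyC; apply: (PM) => //.
rewrite mpolyXE_id; apply: big_ind => // i _.
by elim: (m i) => [|k IH]; rewrite ?expr0 // exprS; apply: (PM).
Qed.

Lemma mulmnDr (n : nat) (m : 'X_{1..n}) i j : (m *+ (i + j) = m *+ i + m *+ j)%MM.
Proof. by apply/mnmP => k; rewrite mnmDE !mulmnE mulnDr. Qed.

Section Degree.
Variables (R : realDomainType) (n : nat).
Implicit Types (p q h : {mpoly R[n]}).

Lemma leq_msizeP k p :
  reflect (forall m, m \in msupp p -> (mdeg m < k)%N) (msize p <= k)%N.
Proof.
rewrite msizeE; apply: (iffP (bigmax_leqP_seq _ _ _ _)) => H m; last by move=> + _; apply: H.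
by move=> mp; apply: H.
Qed.

Lemma leq_msizeM j k p q :
  (msize p <= j.+1)%N -> (msize q <= k.+1)%N -> (msize (p * q) <= (j + k).+1)%N.
Proof.
move=> pj qk; have [->|p0] := eqVneq p 0; first by rewrite mul0r msize0.
have [->|q0] := eqVneq q 0; first by rewrite mulr0 msize0.
rewrite msizeM //; have := leq_add pj qk.
by rewrite addSn addnS; case: (_ + _)%N.
Qed.

Lemma leq_msize_mderiv i p : (msize p^`M(i) <= (msize p).-1)%N.
Proof.
apply/leq_msizeP => m; rewrite mcoeff_msupp mcoeff_mderiv => nz.
have : (m + U_(i))%MM \in msupp p.
  by rewrite mcoeff_msupp; apply: contraNneq nz => ->; rewrite mul0rn.
move/msize_mdeg_lt; rewrite mdegD mdeg1 addn1.
by case: (msize p).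
Qed.

(* The squared coefficients at the largest leading monomial cannot cancel. *)
Lemma msize_sum_sqr (I : finType) (h : I -> {mpoly R[n]}) k i :
  (msize (\sum_j h j ^+ 2) <= k)%N -> (2 * msize (h i) <= k.+1)%N.
Proof.
move=> hk; have [->|hi0] := eqVneq (h i) 0; first by rewrite msize0.
have [i0 hi00 maxM] := (@arg_maxP _ _ _ i (fun j => h j != 0) (fun j => mlead (h j)) hi0).
set M := mlead (h i0).
have leM j : (mlead (h j) <= M)%O.
  have [->|/maxM //] := eqVneq (h j) 0; by rewrite mlead0 le0x.
have : (M + M)%MM \in msupp (\sum_j h j ^+ 2).
  rewrite mcoeff_msupp raddf_sum /=.
  under eq_bigr do rewrite expr2 mleadcMW //.
  rewrite gt_eqF // (bigD1 i0) //= ltr_wpDr //.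
    by apply: sumr_ge0 => j _; rewrite -expr2 sqr_ge0.
  by rewrite -expr2 exprn_even_gt0 //= mleadc_eq0.
move/msize_mdeg_lt/leq_trans => /(_ _ hk); rewrite mdegD.
have := lemc_mdeg (leM i); rewrite -(mlead_deg hi0).
move: (mdeg _) (mdeg _) => a b ab bk.
by rewrite mulnS mul2n -addnn add2n !ltnS (leq_trans _ bk) // ltnS leq_add.
Qed.

End Degree.

(** * The moment functional: linearity and nonnegativity on squares *)

Section Functional.
Variables (R : realType) (n D : nat) (y : 'X_{1..n} -> R).
Implicit Types (p h : {mpoly R[n]}).

(** The index set no longer depends on [h], so linearity can be read off. *)
Lemma LfunE h : Lfun D y h = \sum_(b : 'X_{1..n < D.+1}) h@_b * y b.
Proof.
rewrite /Lfun -big_filter (big_mksub 'X_{1..n < D.+1}) /=.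
- rewrite big_rmcond //= => b; rewrite mem_filter -ltnS bmdeg /=.
  by move/memN_msupp_eq0 ->; rewrite mul0r.
- by rewrite filter_uniq ?msupp_uniq.
- by move=> m; rewrite mem_filter => /andP[].
Qed.

Lemma Lfun_is_linear : linear_for *%R (Lfun D y).
Proof.
move=> c p h; rewrite !LfunE mulr_sumr -big_split /=; apply: eq_bigr => b _.
by rewrite mcoeffD mcoeffZ mulrDl mulrA.
Qed.

HB.instance Definition _ :=
  GRing.isLinear.Build R {mpoly R[n]} R _ (Lfun D y) Lfun_is_linear.

Lemma LfunZ c h : Lfun D y (c *: h) = c * Lfun D y h.
Proof. exact: linearZ. Qed.

Lemma LfunX m : (mdeg m <= D)%N -> Lfun D y 'X_[m] = y m.
Proof. by move=> mD; rewrite /Lfun msuppX big_mkcond big_seq1 mD mcoeffX eqxx mul1r. Qed.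

Lemma LfunC c : Lfun D y c%:MP = c * y 0%MM.
Proof. by rewrite -[c%:MP]mulr1 mul_mpolyC LfunZ -mpolyX0 LfunX ?mdeg0. Qed.

(** The value is the quadratic form of the moment matrix at the coefficient vector of [h];
    [2 * k <= D] ensures that no monomial of the square is truncated. *)
Lemma Lfun_sqr_ge0 k h : (2 * k <= D)%N ->
  psd (fun b c : 'X_{1..n < k.+1} => y (bmnm b + bmnm c)%MM) ->
  (msize h <= k.+1)%N -> 0 <= Lfun D y (h ^+ 2).
Proof.
move=> kD py hk; have := py (fun b => h@_b).
suff -> : Lfun D y (h ^+ 2) =
  \sum_(b : 'X_{1..n < k.+1}) \sum_(c : 'X_{1..n < k.+1}) h@_b * y (b + c)%MM * h@_c by [].
rewrite expr2 {1 2}(mpolywE hk) mulr_suml raddf_sum; apply: eq_bigr => b _.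
rewrite mulr_sumr raddf_sum; apply: eq_bigr => c _.
rewrite -scalerAl -scalerAr -mpolyXD /= !LfunZ LfunX; first by ring.
rewrite mdegD (leq_trans _ kD) // mul2n -addnn.
by rewrite leq_add // -ltnS bmdeg.
Qed.

Lemma univE (j : 'I_n) (q : {poly R}) k : (size q <= k)%N ->
  univ j q = \sum_(i < k) q`_i *: 'X_[(U_(j) *+ i)%MM].
Proof.
move=> qk; rewrite /univ (horner_coef_wide (n := k)).
  by apply: eq_bigr => i _; rewrite coef_map /= mpolyXn mul_mpolyC.
by rewrite size_map_inj_poly ?mpolyC0 // => a b /eqP; rewrite mpolyC_eq => /eqP.
Qed.

Lemma univ_is_linear (j : 'I_n) : linear (@univ R n j).
Proof.
move=> c p q; rewrite /univ -mul_polyC rmorphD rmorphM /= map_polyC /=.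
by rewrite hornerD hornerM hornerC mul_mpolyC.
Qed.

HB.instance Definition _ (j : 'I_n) :=
  GRing.isLinear.Build R {poly R} {mpoly R[n]} _ (@univ R n j) (univ_is_linear j).

Lemma univB (j : 'I_n) (p q : {poly R}) : univ j (p - q) = univ j p - univ j q.
Proof. exact: raddfB. Qed.

Lemma univZ (j : 'I_n) c (q : {poly R}) : univ j (c *: q) = c *: univ j q.
Proof. exact: linearZ. Qed.

Lemma univX (j : 'I_n) : univ j 'X = 'X_j :> {mpoly R[n]}.
Proof. by rewrite /univ map_polyX hornerX. Qed.

Lemma univC (j : 'I_n) c : univ j c%:P = c%:MP :> {mpoly R[n]}.
Proof. by rewrite /univ map_polyC hornerC. Qed.

Lemma univXn (j : 'I_n) (q : {poly R}) k : univ j (q ^+ k) = univ j q ^+ k.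
Proof. by rewrite /univ rmorphXn horner_exp. Qed.

Lemma meval_univ (j : 'I_n) (q : {poly R}) z : (univ j q).@[z] = q.[z j].
Proof.
rewrite (univE _ _ _ (leqnn _)) raddf_sum /= horner_coef; apply: eq_bigr => i _.
by rewrite mevalZ -mpolyXn rmorphXn /= mevalXU.
Qed.

Lemma leq_msize_univ (j : 'I_n) (q : {poly R}) k :
  (size q <= k)%N -> (msize (univ j q) <= k)%N.
Proof.
move=> qk; rewrite (univE _ _ _ qk); apply: leq_trans (msize_sum _ _ _) _.
apply/bigmax_leqP => i _; apply: leq_trans (msizeZ_le _ _) _.
by rewrite msizeX mdegMn mdeg1 mul1n.
Qed.

(** Only powers of x_j occur, so the moment matrix of the single variable x_j suffices. *)
Lemma Lfun_univ_sqr_ge0 (j : 'I_n) k (q : {poly R}) : (2 * k <= D)%N ->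
  psd (fun a b : 'I_k.+1 => y (U_(j) *+ (a + b))%MM) ->
  (size q <= k.+1)%N -> 0 <= Lfun D y (univ j (q ^+ 2)).
Proof.
move=> kD py qk; have := py (fun a => q`_a).
suff -> : Lfun D y (univ j (q ^+ 2)) =
  \sum_(a < k.+1) \sum_(b < k.+1) q`_a * y (U_(j) *+ (a + b))%MM * q`_b by [].
rewrite univXn (univE _ _ _ qk) expr2 mulr_suml raddf_sum; apply: eq_bigr => a _.
rewrite mulr_sumr raddf_sum; apply: eq_bigr => b _.
rewrite -scalerAl -scalerAr -mpolyXD /= !LfunZ -mulmnDr LfunX; first by ring.
rewrite mdegMn mdeg1 mul1n (leq_trans _ kD) // mul2n -addnn.
by rewrite leq_add // -ltnS.
Qed.

End Functional.

(** * Restriction to a segment: p(a + s (x - a)) as a polynomial in s with coefficients in R[x] *)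

(* Locked: otherwise comparing two instances unfolds [mmap] and takes minutes. *)
HB.lock Definition segment (R : realType) (n : nat) (a : 'I_n -> R) :
    {mpoly R[n]} -> {poly {mpoly R[n]}} :=
  mmap (polyC \o @mpolyC n R)
    (fun j => (a j)%:MP%:P + ('X_j - (a j)%:MP)%:P * 'X).

Section Segment.
Variables (R : realType) (n : nat) (a : 'I_n -> R).
Implicit Types (p q : {mpoly R[n]}).
Local Notation segment := (segment R n a).

Lemma segment_is_zmod_morphism : zmod_morphism segment.
Proof. by rewrite segment.unlock => p q; exact: raddfB. Qed.

Lemma segment_is_monoid_morphism : monoid_morphism segment.
Proof. by rewrite segment.unlock; split => [|p q]; [exact: rmorph1 | exact: rmorphM]. Qed.

HB.instance Definition _ := GRing.isZmodMorphism.Build _ _ segment segment_is_zmod_morphism.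
HB.instance Definition _ := GRing.isMonoidMorphism.Build _ _ segment segment_is_monoid_morphism.

Lemma segmentC c : segment c%:MP = c%:MP%:P.
Proof. by rewrite segment.unlock mmapC. Qed.

Lemma segmentX j :
  segment 'X_j = (a j)%:MP%:P + ('X_j - (a j)%:MP)%:P * 'X.
Proof. by rewrite segment.unlock mmapX mmap1U. Qed.

Lemma segmentD p q : segment (p + q) = segment p + segment q.
Proof. exact: raddfD. Qed.

Lemma segmentM p q : segment (p * q) = segment p * segment q.
Proof. exact: rmorphM. Qed.

Lemma segment0 p : (segment p).[0] = p.@[a]%:MP.
Proof.
elim/mpoly_alg_ind: p => [c|j|p q|p q].
- by rewrite segmentC hornerC mevalC.
- by rewrite segmentX !hornerE mevalXU ?(mulr0, addr0).
- by move=> IHp IHq; rewrite segmentD hornerD mevalD mpolyCD; congr (_ + _).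
- by move=> IHp IHq; rewrite segmentM hornerM mevalM mpolyCM; congr (_ * _).
Qed.

Lemma segment1 p : (segment p).[1] = p.
Proof.
elim/mpoly_alg_ind: p => [c|j|p q|p q].
- by rewrite segmentC hornerC.
- by rewrite segmentX !hornerE /= addrC addKr.
- by move=> IHp IHq; rewrite segmentD hornerD; congr (_ + _).
- by move=> IHp IHq; rewrite segmentM hornerM; congr (_ * _).
Qed.

(** Chain rule along s -> a + s (x - a). Both sides are additive and obey the Leibniz rule, so
    constants and variables suffice. *)
Lemma deriv_segment p :
  (segment p)^`() = \sum_j segment p^`M(j) * ('X_j - (a j)%:MP)%:P.
Proof.
elim/mpoly_alg_ind: p => [c|i|p q IHp IHq|p q IHp IHq].
- rewrite segmentC derivC big1 // => j _.
  by rewrite mderivC raddf0 mul0r.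
- rewrite segmentX derivD derivM !derivC derivX mul0r mulr1 !add0r (bigD1 i) //= big1 => [|j ji].
    have -> : (U_(i) = 0 + U_(i) :> 'X_{1..n})%MM by rewrite add0m.
    by rewrite mderivX addmK add0m mnm1E eqxx scale1r mpolyX0 rmorph1 mul1r addr0.
  by rewrite mderivX mnm1E eq_sym (negbTE ji) scale0r raddf0 mul0r.
- rewrite segmentD derivD IHp IHq -big_split; apply: eq_bigr => j _ /=.
  by rewrite mderivD segmentD mulrDl.
- rewrite segmentM derivM IHp IHq mulr_suml mulr_sumr -big_split.
  apply: eq_bigr => j _ /=.
  by rewrite mderivM segmentD !segmentM; ring.
Qed.

(** For a fixed real s, each variable is replaced by a polynomial of degree at most one, so no
    monomial gains degree. *)
Lemma leq_msize_segment p s : (msize (segment p).[s%:MP] <= msize p)%N.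
Proof.
have lC k (c : R) : (msize (c%:MP_[n]) <= k.+1)%N.
  by rewrite msizeC (leq_trans (leq_b1 _)).
rewrite {1}(mpolyE p) raddf_sum horner_sum /=.
apply: leq_trans (msize_sum _ _ _) _; rewrite big_seq.
apply/bigmax_leqP_seq => m _ mp; apply: leq_trans (msize_mdeg_lt mp).
rewrite -mul_mpolyC mpolyXE_id segmentM rmorph_prod segmentC hornerM hornerC horner_prod.
(* The degree is counted as 0 for the coefficient plus the sum of the exponents, matched factor by
   factor with the product. *)
rewrite -[mdeg m]add0n; apply: leq_msizeM; first exact: lC.
rewrite mdegE; apply: (big_ind2 (fun (q : {mpoly R[n]}) k => (msize q <= k.+1)%N)).
- by rewrite -mpolyC1; exact: lC.
- by move=> q1 k1 q2 k2; exact: leq_msizeM.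
move=> j _; rewrite rmorphXn horner_exp /= segmentX hornerD hornerMX !hornerC.
elim: (m j) => [|k IH]; first by rewrite expr0 -mpolyC1 lC.
rewrite exprS; apply: (leq_msizeM _ _ 1 k) => //.
apply: leq_trans (msizeD_le _ _) _; rewrite geq_max lC /=.
rewrite mulrC mul_mpolyC; apply: leq_trans (msizeZ_le _ _) _.
apply: leq_trans (msizeD_le _ _) _.
by rewrite msizeN geq_max lC msizeX mdeg1.
Qed.

End Segment.

(** * Jensen's inequality for the moment functional *)

Section Jensen.
Variables (R : realType) (n D : nat) (y : 'X_{1..n} -> R).

(** This makes the first-order terms at the mean vanish in both Jensen inequalities. *)
Lemma Lfun_mean (j : 'I_n) : (0 < D)%N -> y 0%MM = 1 ->
  Lfun D y ('X_j - (y U_(j)%MM)%:MP) = 0.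
Proof. by move=> D0 y0; rewrite raddfB /= LfunC LfunX ?mdeg1 // y0 mulr1 subrr. Qed.

(** [Lfun D y] is linear but not multiplicative, so it commutes with evaluation at real constants
    [s%:MP], whose powers are scalars. *)
Lemma horner_map_Lfun (P : {poly {mpoly R[n]}}) s :
  (map_poly (Lfun D y) P).[s] = Lfun D y P.[s%:MP].
Proof.
rewrite (horner_coef_wide _ (size_poly _ _)) horner_coef raddf_sum.
apply: eq_bigr => i _; rewrite coef_map /=.
by rewrite -rmorphXn /= [P`_i * _]mulrC mul_mpolyC LfunZ mulrC.
Qed.

Lemma deriv_map_Lfun (P : {poly {mpoly R[n]}}) :
  (map_poly (Lfun D y) P)^`() = map_poly (Lfun D y) P^`().
Proof. by apply/polyP => i; rewrite !(coef_map, coef_deriv) /= raddfMn. Qed.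

Lemma Lfun_univ_jensen (j : 'I_n) k (v : {poly R}) :
  (0 < D)%N -> y 0%MM = 1 -> (2 * k <= D)%N ->
  psd (fun b c : 'I_k.+1 => y (U_(j) *+ (b + c))%MM) ->
  convex_poly v -> (size v <= (2 * k).+1)%N ->
  v.[y U_(j)%MM] <= Lfun D y (univ j v).
Proof.
move=> D0 y0 kD py cv sv; set x := y _.
pose q := v - v.[x]%:P - v^`().[x] *: ('X - x%:P).
have q0 t : 0 <= q.[t].
  by rewrite !hornerE; have := convex_poly_tangent _ _ x t cv; lra.
have sq : (size q <= (2 * k).+1)%N.
  (* For k = 0 the linear term would exceed the size bound, but then [v] is constant and [q] is
     zero. *)
  case: k sv {kD py} => [|k] sv.
    have vE := size1_polyC sv.
    by rewrite /q vE derivC horner0 scale0r subr0 hornerC subrr size_poly0.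
  have s2 : (2 <= (2 * k.+1).+1)%N by rewrite mulnS.
  apply: leq_trans (size_polyD _ _) _; rewrite geq_max size_polyN; apply/andP; split.
    apply: leq_trans (size_polyD _ _) _; rewrite geq_max sv size_polyN /=.
    by apply: leq_trans (size_polyC_leq1 _) _.
  by apply: leq_trans (size_scale_leq _ _) _; rewrite size_XsubC.
have [hs qE Hhs] := nonneg_poly_sos _ k q q0 sq.
have : 0 <= Lfun D y (univ j q).
  rewrite qE !raddf_sum big_seq; apply: sumr_ge0 => h /Hhs sh.
  exact: (Lfun_univ_sqr_ge0 _ _ _ _ _ k).
have -> : univ j q = univ j v - v.[x]%:MP - v^`().[x] *: ('X_j - x%:MP).
  by rewrite /q !(univB, univZ) !univC univX.
rewrite raddfB raddfB /= LfunZ.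
by rewrite Lfun_mean // mulr0 subr0 LfunC y0 mulr1 subr_ge0.
Qed.

(** The Hessian factorisation is a polynomial identity, so it can be restricted to the segment
    before [Lfun D y] is applied. The degree bound on [F] keeps the resulting squares within the
    moment matrix of order [r]. *)
Lemma Lfun_sos_convex_jensen (p : {mpoly R[n]}) r :
  (0 < D)%N -> y 0%MM = 1 -> (2 * r <= D)%N ->
  psd (fun b c : 'X_{1..n < r.+1} => y (bmnm b + bmnm c)%MM) ->
  sos_convex p -> (msize p <= (2 * r).+1)%N ->
  p.@[fun j => y U_(j)%MM] <= Lfun D y p.
Proof.
pose a j := y U_(j)%MM; move=> D0 y0 rD py [k [F HF]] pr.
pose phi := map_poly (Lfun D y) (segment _ _ a p).
have HFE i j : p^`M(j)^`M(i) = \sum_l F l i * F l j.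
  have /matrixP/(_ i j) := HF; rewrite !mxE => ->.
  by apply: eq_bigr => l _; rewrite mxE.
have phi0 : phi.[0] = p.@[a].
  by rewrite horner_map_Lfun mpolyC0 segment0 LfunC y0 mulr1.
have phi1 : phi.[1] = Lfun D y p.
  by rewrite horner_map_Lfun mpolyC1 segment1.
(* At s = 0 the chain rule leaves constants times the centred variables. *)
have dphi0 : phi^`().[0] = 0.
  rewrite deriv_map_Lfun horner_map_Lfun mpolyC0 deriv_segment horner_sum.
  rewrite raddf_sum big1 // => j _.
  by rewrite hornerM hornerC segment0 mul_mpolyC /= LfunZ Lfun_mean // mulr0.
(* The j-th diagonal entry of the Hessian is the sum over l of (F l j)^2 and has degree at most 2r -
   2. Leading terms of squares do not cancel, so [F l j] has degree at most r - 1, and is zero when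
   r = 0. *)
have sF l j : (msize (F l j) <= r)%N.
  have : (msize (\sum_l F l j ^+ 2) <= (2 * r).-1)%N.
    under eq_bigr do rewrite expr2.
    rewrite -HFE; apply: leq_trans (leq_msize_mderiv _ _ _ _) _.
    rewrite -!subn1 leq_sub2r // (leq_trans (leq_msize_mderiv _ _ j p)) //.
    by rewrite -subn1 leq_subLR.
  move/(msize_sum_sqr _ _ _ (fun l => F l j) _ l).
  move: (msize (F l j)) => N; case: (r) => [|r']; first by case: N => // N; rewrite mulnS.
  by rewrite prednK ?muln_gt0 // leq_pmul2l.
have ddphi s : 0 <= phi^`()^`().[s].
  rewrite !deriv_map_Lfun horner_map_Lfun.
  (* [h l] is the l-th entry of F(a + s (x - a)) (x - a), so the second derivative before applying
     [Lfun D y] is the squared norm of this vector. *)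
  pose h l := \sum_j (segment _ _ a (F l j)).[s%:MP] * ('X_j - (a j)%:MP).
  have -> : (segment _ _ a p)^`()^`().[s%:MP] = \sum_l h l ^+ 2.
    rewrite deriv_segment raddf_sum horner_sum /=.
    under [RHS]eq_bigr => l _ do rewrite /h expr2 mulr_sumr.
    rewrite [RHS]exchange_big; apply: eq_bigr => j _ /=.
    rewrite derivM derivC mulr0 addr0 deriv_segment mulr_suml horner_sum.
    under [RHS]eq_bigr => l _ do rewrite mulr_suml.
    rewrite [RHS]exchange_big; apply: eq_bigr => i _ /=.
    rewrite HFE rmorph_sum !mulr_suml horner_sum; apply: eq_bigr => l _.
    by rewrite /= segmentM !hornerM !hornerC; ring.
  rewrite raddf_sum; apply: sumr_ge0 => l _; apply: (Lfun_sqr_ge0 _ _ _ _ r) => //.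
  apply: leq_trans (msize_sum _ _ _) _; apply/bigmax_leqP => j _.
  (* A nonzero entry forces r > 0, so that (r - 1) + 1 = r holds for natural numbers. *)
  have [Flj0|Flj0] := eqVneq (F l j) 0.
    by rewrite Flj0 raddf0 horner0 mul0r msize0.
  have r0 : (0 < r)%N.
    by apply: leq_trans (sF l j); rewrite lt0n msize_poly_eq0.
  rewrite -(prednK r0) -addn1; apply: leq_msizeM.
    by rewrite prednK //; apply: leq_trans (leq_msize_segment _ _ _ _ _) _.
  apply: leq_trans (msizeD_le _ _) _.
  by rewrite msizeN geq_max msizeX mdeg1 msizeC (leq_trans (leq_b1 _)).
(* Two mean value steps replace Taylor's formula: phi(1) - phi(0) = phi'(c) = c phi''(e) with c >
   0. *)
have [c /andP[c0 _]] := poly_mvt phi (@ltr01 R).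
rewrite subr0 mulr1 phi0 phi1 => Hc.
have [e _] := poly_mvt phi^`() c0.
rewrite dphi0 !subr0 => He.
by rewrite -subr_ge0 Hc He mulr_ge0 // ltW.
Qed.

End Jensen.

(** * Moment vectors of points *)

Section Moments.
Variables (R : realType) (n : nat) (z : 'I_n -> R).

(** The moment sequence of the Dirac measure at [z]. *)
Definition moments (m : 'X_{1..n}) : R := ('X_[m] : {mpoly R[n]}).@[z].

Lemma momentsD m1 m2 : moments (m1 + m2)%MM = moments m1 * moments m2.
Proof. by rewrite /moments mpolyXD mevalM. Qed.

Lemma Lfun_moments D h : (msize h <= D.+1)%N -> Lfun D moments h = h.@[z].
Proof.
move=> hD; rewrite {2}(mpolywE hD) LfunE raddf_sum; apply: eq_bigr => b _.
by rewrite /= mevalZ.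
Qed.

Lemma psd_rank_one (T : finType) (w : T -> R) : psd (fun b c => w b * w c).
Proof.
move=> v; suff -> : \sum_b \sum_c v b * (w b * w c) * v c = (\sum_b v b * w b) ^+ 2.
  exact: sqr_ge0.
rewrite expr2 mulr_suml; apply: eq_bigr => b _; rewrite mulr_sumr.
by apply: eq_bigr => c _; ring.
Qed.

(** Moments of a point are multiplicative, so its moment matrices have rank one; the size bound
    keeps every term of [g i] in the truncated sum. *)
Lemma spld_feasible_moments (d : 'I_n -> nat) (r m : nat) (g : 'I_m -> {mpoly R[n]}) :
  (forall i, (msize (g i) <= (2 * \max_(j < n) d j).+1)%N) ->
  cp_feasible g z -> spld_feasible d r g moments.
Proof.
move=> sg gz; split.
- by move=> i; rewrite Lfun_moments.
- move=> j v; under eq_bigr do under eq_bigr do rewrite mulmnDr momentsD.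
  exact: psd_rank_one.
- move=> v; under eq_bigr do under eq_bigr do rewrite momentsD.
  exact: psd_rank_one.
- by rewrite /moments mpolyX0 meval1.
Qed.

End Moments.

(** * Exactness of the relaxation *)

Theorem theorem5 (R : realType) (n m r : nat) (d : 'I_n -> nat)
    (u0 : 'I_n -> {poly R}) (p0 : {mpoly R[n]})
    (u : 'I_m -> 'I_n -> {poly R}) (p : 'I_m -> {mpoly R[n]})
    (f : {mpoly R[n]}) (g : 'I_m -> {mpoly R[n]}) :
  f = \sum_(j < n) univ j (u0 j) + p0 ->
  (forall i, g i = \sum_(j < n) univ j (u i j) + p i) ->
  convex_mpoly f ->
  (forall i, convex_mpoly (g i)) ->
  (forall j, convex_poly (u0 j) /\ (size (u0 j) <= (2 * d j).+1)%N) ->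
  (forall i j, convex_poly (u i j) /\ (size (u i j) <= (2 * d j).+1)%N) ->
  sos_convex p0 -> (msize p0 <= (2 * r).+1)%N ->
  (forall i, sos_convex (p i) /\ (msize (p i) <= (2 * r).+1)%N) ->
  (r < \max_(j < n) d j)%N ->
  (exists c : R, forall x, cp_feasible g x -> c <= f.@[x]) ->
  (exists xh : 'I_n -> R, cp_feasible g xh /\ forall i, (g i).@[xh] < 0) ->
  forall ybar : 'X_{1..n} -> R,
    spld_optimal d r f g ybar ->
    cp_optimal f g (fun j => ybar (U_(j))%MM).
Proof.
move=> fE gE _ _ cu0 cu cp0 sp0 cp rd _ _ y [[yg yd yr y0] yopt].
set D := (2 * \max_(j < n) d j)%N in yg yopt.
have D_gt0 : (0 < D)%N by rewrite muln_gt0 (leq_ltn_trans _ rd).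
have rD : (2 * r <= D)%N by rewrite leq_pmul2l // ltnW.
have dD j : (2 * d j <= D)%N by rewrite leq_pmul2l // leq_bigmax.
(* Polynomials of this shape lie within the truncation degree [D], so on moment vectors of points
   the functional is evaluation. *)
have size_spld (v : 'I_n -> {poly R}) (q : {mpoly R[n]}) :
    (forall j, size (v j) <= (2 * d j).+1)%N -> (msize q <= (2 * r).+1)%N ->
    (msize (\sum_(j < n) univ j (v j) + q) <= D.+1)%N.
  move=> sv sq; apply: leq_trans (msizeD_le _ _) _.
  rewrite geq_max (leq_trans sq) // andbT.
  apply: leq_trans (msize_sum _ _ _) _; apply/bigmax_leqP => j _.
  by apply: leq_msize_univ; apply: leq_trans (sv j) _; rewrite ltnS.
have jensen (v : 'I_n -> {poly R}) (q : {mpoly R[n]}) :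
    (forall j, convex_poly (v j) /\ (size (v j) <= (2 * d j).+1)%N) ->
    sos_convex q -> (msize q <= (2 * r).+1)%N ->
    (\sum_(j < n) univ j (v j) + q).@[fun j => y U_(j)%MM] <=
    Lfun D y (\sum_(j < n) univ j (v j) + q).
  move=> Hv cq sq; rewrite mevalD raddfD lerD //=; last first.
    exact: (Lfun_sos_convex_jensen _ _ _ _ _ r).
  rewrite !raddf_sum; apply: ler_sum => j _ /=; rewrite meval_univ.
  have [cv sv] := Hv j.
  exact: (Lfun_univ_jensen _ _ _ _ _ (d j)).
split=> [i|z zg].
  apply: le_trans (yg i); rewrite gE.
  by have [? ?] := cp i; apply: jensen.
have sg i : (msize (g i) <= D.+1)%N.
  by rewrite gE; apply: size_spld => [j|]; [have [] := cu i j | have [] := cp i].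
have sf : (msize f <= D.+1)%N.
  by rewrite fE; apply: size_spld => // j; have [] := cu0 j.
(* The moment vector of the feasible point [z] competes with [y] in the relaxation. *)
have := yopt _ (spld_feasible_moments _ _ z d r m g sg zg).
rewrite Lfun_moments //; apply: le_trans.
by rewrite fE; apply: jensen.
Qed.
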